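(* Let $\mathbb{X}\subset\mathbb{R}^{n_{\mathbb{X}}}$ and $\mathbb{U}\subset\mathbb{R}^{n_{\mathbb{U}}}$, let $G:\mathbb{X}\times\mathbb{U}\to\mathbb{X}$ be a monotone bioeconomic dynamics (increasing with respect to the state and decreasing with respect to the control), suppose that the control set $\mathbb{U}$ has lower and upper bounds $u^{\flat},u^{\sharp}\in\mathbb{U}$, i.e. $u^{\flat}\le u\le u^{\sharp}$ for all $u\in\mathbb{U}$, and let $\mathbb{D}\subset\mathbb{X}\times\mathbb{U}$. With $G^{\flat},G^{\sharp},\mathbb{D}^{\flat},\mathbb{D}^{\sharp}$ and the viability kernels $\mathbb{V}(\cdot,\cdot)$ as defined in the context: 1. If $\mathbb{D}$ is a production acceptable set, then $$\mathbb{V}(G^{\sharp},\mathbb{D}^{\flat})\subseteq \mathbb{V}(G^{\flat},\mathbb{D}^{\flat})\cup\mathbb{V}(G^{\sharp},\mathbb{D}^{\sharp})\subseteq\mathbb{V}(G,\mathbb{D})\subseteq\mathbb{V}(G^{\flat},\mathbb{D}^{\sharp}).$$ 2. If $\mathbb{D}$ is a preservation acceptable set, then $$\mathbb{V}(G^{\sharp},\mathbb{D}^{\sharp})\subseteq\mathbb{V}(G,\mathbb{D})=\mathbb{V}(G^{\flat},\mathbb{D}^{\flat}).$$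
   Context: Orders: $\mathbb{X}\subset\mathbb{R}^{n_{\mathbb{X}}}$ and $\mathbb{U}\subset\mathbb{R}^{n_{\mathbb{U}}}$ carry the componentwise order ($x'\ge x$ iff $x'_i\ge x_i$ for every $i$). Monotone bioeconomic dynamics: a map $G:\mathbb{X}\times\mathbb{U}\to\mathbb{X}$ such that $x'\ge x\Rightarrow G(x',u)\ge G(x,u)$ for all $x,x'\in\mathbb{X}$, $u\in\mathbb{U}$ (increasing with respect to the state), and $u'\ge u\Rightarrow G(x,u')\le G(x,u)$ for all $x\in\mathbb{X}$, $u,u'\in\mathbb{U}$ (decreasing with respect to the control). Viability kernel: for $G:\mathbb{X}\times\mathbb{U}\to\mathbb{X}$ and $\mathbb{D}\subset\mathbb{X}\times\mathbb{U}$ (the acceptable set), and an initial time $t_0\in\mathbb{N}$ (the set does not depend on it), $\mathbb{V}(G,\mathbb{D})$ is the set of $x\in\mathbb{X}$ for which there exist sequences $(u(t))_{t\ge t_0}$ in $\mathbb{U}$ and $(x(t))_{t\ge t_0}$ in $\mathbb{X}$ with $x(t_0)=x$, $x(t+1)=G(x(t),u(t))$ and $(x(t),u(t))\in\mathbb{D}$ for all integers $t\ge t_0$. Dynamics without control: $G^{\flat}(x):=G(x,u^{\flat})$ and $G^{\sharp}(x):=G(x,u^{\sharp})$, maps $\mathbb{X}\to\mathbb{X}$. For a map $H:\mathbb{X}\to\mathbb{X}$ and a set $\mathbb{D}'\subset\mathbb{X}\times\mathbb{U}$, $\mathbb{V}(H,\mathbb{D}')$ is the viability kernel of $H$ regarded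 as a dynamics $(x,u)\mapsto H(x)$ that does not depend on the control; equivalently, $\mathbb{V}(H,\mathbb{D}')=\bigcap_{t=0}^{+\infty}\{x\in\mathbb{X}\mid H^{(t)}(x)\in\mathrm{Proj}_{\mathbb{X}}(\mathbb{D}')\}$, where $H^{(t)}$ is the $t$-th iterate and $\mathrm{Proj}_{\mathbb{X}}(\mathbb{D}')=\{x\in\mathbb{X}\mid\exists u\in\mathbb{U},\ (x,u)\in\mathbb{D}'\}$. Derived acceptable sets: $\mathbb{V}_0^{\sharp}:=\{x\in\mathbb{X}\mid(x,u^{\sharp})\in\mathbb{D}\}$, $\mathbb{D}^{\sharp}:=\mathbb{V}_0^{\sharp}\times\{u^{\sharp}\}$, $\mathbb{V}_0^{\flat}:=\{x\in\mathbb{X}\mid(x,u^{\flat})\in\mathbb{D}\}$, $\mathbb{D}^{\flat}:=\mathbb{V}_0^{\flat}\times\{u^{\flat}\}$. $\mathbb{D}$ is a production acceptable set if for all $x,x'\in\mathbb{X}$, $u,u'\in\mathbb{U}$: $x'\ge x$, $u'\ge u$, $(x,u)\in\mathbb{D}$ imply $(x',u')\in\mathbb{D}$. $\mathbb{D}$ is a preservation acceptable set if for all $x,x'\in\mathbb{X}$, $u,u'\in\mathbb{U}$: $x'\ge x$, $u'\le u$, $(x,u)\in\mathbb{D}$ imply $(x',u')\in\mathbb{D}$. *)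

(* Defs.v *)
From mathcomp Require Import all_boot all_order all_algebra.
From mathcomp Require Import all_classical all_reals.

Set Implicit Arguments.
Unset Strict Implicit.
Unset Printing Implicit Defensive.

Import Order.TTheory GRing.Theory Num.Theory.

Local Open Scope ring_scope.
Local Open Scope classical_set_scope.

(* A map X * U -> X between subsets of real vector spaces is
   a total function on the ambient spaces sending X `*` U to X
   ([set_fun (X `*` U) X G]); its values outside X `*` U are never used. *)

(* The library puts no order on row vectors. *)
Definition cw_le (R : realType) (n : nat) (x y : 'rV[R]_n) : Prop :=
  forall i : 'I_n, x ord0 i <= y ord0 i.

Section Bioeconomic.
Variables (R : realType) (nX nU : nat).
Variables (X : set 'rV[R]_nX) (U : set 'rV[R]_nU).

Implicit Types (G : 'rV[R]_nX * 'rV[R]_nU -> 'rV[R]_nX).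
Implicit Types (D : set ('rV[R]_nX * 'rV[R]_nU)).

Definition increasing_in_state G : Prop :=
  forall x x' u, X x -> X x' -> U u -> cw_le x x' -> cw_le (G (x, u)) (G (x', u)).

Definition decreasing_in_control G : Prop :=
  forall x u u', X x -> U u -> U u' -> cw_le u u' -> cw_le (G (x, u')) (G (x, u)).

Definition monotone_bioeconomic G : Prop :=
  [/\ set_fun (X `*` U) X G, increasing_in_state G & decreasing_in_control G].

(* The sequences are indexed by all of nat, but only their values at times
   t >= t0 are constrained. *)
Definition viability_kernel (t0 : nat) G D : set 'rV[R]_nX :=
  [set x | X x /\
    exists (u : nat -> 'rV[R]_nU) (y : nat -> 'rV[R]_nX),
      y t0 = x /\
      forall t, (t0 <= t)%N ->
        [/\ U (u t), X (y t), y t.+1 = G (y t, u t) & D (y t, u t)]].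

Definition frozen_dynamics G (v : 'rV[R]_nU) : 'rV[R]_nX -> 'rV[R]_nX :=
  fun x => G (x, v).

Definition uncontrolled (H : 'rV[R]_nX -> 'rV[R]_nX) :
    'rV[R]_nX * 'rV[R]_nU -> 'rV[R]_nX :=
  fun xu => H xu.1.

Definition frozen_acceptable D (v : 'rV[R]_nU) : set ('rV[R]_nX * 'rV[R]_nU) :=
  [set x | X x /\ D (x, v)] `*` [set v].

Definition production_acceptable D : Prop :=
  forall x x' u u', X x -> X x' -> U u -> U u' ->
    cw_le x x' -> cw_le u u' -> D (x, u) -> D (x', u').

Definition preservation_acceptable D : Prop :=
  forall x x' u u', X x -> X x' -> U u -> U u' ->
    cw_le x x' -> cw_le u' u -> D (x, u) -> D (x', u').

End Bioeconomic.

(* Main.v *)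
(* Freezing the control at the least value u^flat gives, from a given initial
   state, a trajectory that dominates every other one; acceptability then
   transfers upwards along the state, and along the control in the direction
   allowed by the type of the acceptable set. Conversely a viable trajectory
   for a frozen dynamics with its own frozen acceptable set is a viable
   controlled trajectory. *)
Require Import Defs.
From mathcomp Require Import all_boot all_order all_algebra.
From mathcomp Require Import all_classical all_reals.

Local Open Scope ring_scope.
Local Open Scope classical_set_scope.

Lemma cw_le_trans (R : realType) (n : nat) (x y z : 'rV[R]_n) :
  cw_le x y -> cw_le y z -> cw_le x z.
Proof. by move=> xy yz i; apply: Order.POrderTheory.le_trans (xy i) (yz i). Qed.

Section FrozenKernels.
Variables (R : realType) (nX nU : nat).
Variables (X : set 'rV[R]_nX) (U : set 'rV[R]_nU).
Implicit Types (G : 'rV[R]_nX * 'rV[R]_nU -> 'rV[R]_nX).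
Implicit Types (D : set ('rV[R]_nX * 'rV[R]_nU)) (v w : 'rV[R]_nU).

Lemma frozen_kernel_sub (t0 : nat) G D v :
  viability_kernel X U t0 (uncontrolled (frozen_dynamics G v))
    (frozen_acceptable X D v) `<=` viability_kernel X U t0 G D.
Proof.
move=> x [Xx [u [y [y0 hy]]]]; split=> //; exists u, y; split=> // t le_t.
have [Ut Xt ->] := hy t le_t.
by rewrite /frozen_acceptable /= => -[[_ Dt] /= utv]; rewrite -utv in Dt *.
Qed.

(** The states do not react to the control, so the trajectory is kept and only the control sequence
    is replaced, by the constant [w]. *)
Lemma frozen_acceptable_kernel_sub (t0 : nat) H D v w :
  U w -> (forall x, X x -> D (x, v) -> D (x, w)) ->
  viability_kernel X U t0 (uncontrolled H) (frozen_acceptable X D v) `<=`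
  viability_kernel X U t0 (uncontrolled H) (frozen_acceptable X D w).
Proof.
move=> Uw Dvw x [Xx [u [y [y0 hy]]]]; split=> //.
exists (fun=> w), y; split=> // t le_t.
have [_ Xt yS [[_ Dt] _]] := hy t le_t.
by split=> //; split=> //; split=> //; apply: Dvw.
Qed.

(** Two controls are kept apart: [v] drives the dominating trajectory, [w] only tests acceptability.
    Production takes [w] greatest, preservation takes [w] least. *)
Lemma kernel_sub_frozen (t0 : nat) G D v w :
  monotone_bioeconomic X U G ->
  U v -> U w -> (forall u, U u -> cw_le v u) ->
  (forall x x' u, X x -> X x' -> U u -> cw_le x x' -> D (x, u) -> D (x', w)) ->
  viability_kernel X U t0 G D `<=`
  viability_kernel X U t0 (uncontrolled (frozen_dynamics G v))
    (frozen_acceptable X D w).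
Proof.
move=> [GX Gx Gu] Uv Uw v_min Dw x [Xx [u [y [y0 hy]]]]; split=> //.
(* Truncated subtraction makes [z] constantly [x] up to time [t0]. *)
pose z t := iter (t - t0) (frozen_dynamics G v) x.
have Xz t : X (z t).
  by rewrite /z; elim: (t - t0)%N => //= k Xk; apply: GX.
have zS t : (t0 <= t)%N -> z t.+1 = G (z t, v) by move=> le_t; rewrite /z subSn.
have yz k : cw_le (y (t0 + k)%N) (z (t0 + k)%N).
  elim: k => [|k IH]; first by rewrite addn0 /z subnn y0.
  have [Ut Xt yS _] := hy (t0 + k)%N (leq_addr _ _).
  rewrite addnS yS zS ?leq_addr //.
  (* First lower the control to [v] at the state of [y], then raise the state to that of [z]. *)
  apply: (@cw_le_trans _ _ _ (G (y (t0 + k)%N, v))).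
    by apply: Gu => //; apply: v_min.
  exact: Gx.
exists (fun=> w), z; split=> [|t le_t]; first by rewrite /z subnn.
have [Ut Xt _ Dt] := hy t le_t.
split=> //; first by rewrite zS.
split=> //; split=> /=; first exact: Xz.
apply: (Dw (y t) _ (u t)) => //.
by rewrite -(subnKC le_t).
Qed.

End FrozenKernels.

Theorem proposition1 (R : realType) (nX nU : nat)
    (X : set 'rV[R]_nX) (U : set 'rV[R]_nU)
    (G : 'rV[R]_nX * 'rV[R]_nU -> 'rV[R]_nX)
    (hG : monotone_bioeconomic X U G)
    (uflat usharp : 'rV[R]_nU)
    (hflat : U uflat) (hsharp : U usharp)
    (hbounds : forall u, U u -> cw_le uflat u /\ cw_le u usharp)
    (D : set ('rV[R]_nX * 'rV[R]_nU))
    (hD : D `<=` X `*` U)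
    (t0 : nat) :
  let V := viability_kernel X U t0 in
  let Gflat := uncontrolled (frozen_dynamics G uflat) in
  let Gsharp := uncontrolled (frozen_dynamics G usharp) in
  let Dflat := frozen_acceptable X D uflat in
  let Dsharp := frozen_acceptable X D usharp in
  (production_acceptable X U D ->
     [/\ V Gsharp Dflat `<=` V Gflat Dflat `|` V Gsharp Dsharp,
         V Gflat Dflat `|` V Gsharp Dsharp `<=` V G D &
         V G D `<=` V Gflat Dsharp]) /\
  (preservation_acceptable X U D ->
     V Gsharp Dsharp `<=` V G D /\ V G D = V Gflat Dflat).
Proof.
move=> V Gflat Gsharp Dflat Dsharp.
have flat_min u : U u -> cw_le uflat u by case/hbounds.
have sharp_max u : U u -> cw_le u usharp by case/hbounds.
split=> [prod | pres]; split.
(* The second kernel of the union suffices: production allows raising [uflat] to [usharp] at a fixed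
   state. *)
- apply: subset_trans (@subsetUr _ _ _).
  apply: frozen_acceptable_kernel_sub => // x Xx.
  by apply: prod => //; apply: flat_min.
- by rewrite subUset; split; apply: frozen_kernel_sub.
- apply: kernel_sub_frozen => // x x' u Xx Xx' Uu xx'.
  by apply: prod => //; apply: sharp_max.
- exact: frozen_kernel_sub.
- apply/seteqP; split; last exact: frozen_kernel_sub.
  apply: kernel_sub_frozen => // x x' u Xx Xx' Uu xx'.
  by apply: pres => //; apply: flat_min.
Qed.
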